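(* Let $\mathcal{H}=(\mathcal{V},\mathcal{E})$ be an $n$-vertex hypergraph. Suppose that there exist absolute constants $c,c'\ge 0$ such that for every non-empty $\mathcal{V}'\subseteq\mathcal{V}$ the Delaunay graph of the sub-hypergraph of $\mathcal{H}$ induced by $\mathcal{V}'$ has at most $c|\mathcal{V}'|-c'$ edges. Then: (i) The chromatic number of $\mathcal{H}$ is at most $2c+1$ (at most $2c$ if $c'>0$). (ii) The VC-dimension of $\mathcal{H}$ is at most $2c+1$ (at most $2c$ if $c'>0$). (iii) $\mathcal{H}$ has $O(k^{d-1}n)$ hyperedges of size at most $k$, where $d$ is the VC-dimension of $\mathcal{H}$.
   Context: The sub-hypergraph of $\mathcal{H}=(\mathcal{V},\mathcal{E})$ induced by $\mathcal{V}'\subseteq\mathcal{V}$ has vertex set $\mathcal{V}'$ and its hyperedges are the non-empty subsets in $\{h\cap\mathcal{V}'\mid h\in\mathcal{E}\}$ (the trace, or restriction, to $\mathcal{V}'$). The Delaunay graph of a hypergraph is the graph on the same vertex set whose edges are the hyperedges of size exactly two. The chromatic number of a hypergraph is the minimum number of colors in a proper coloring of its vertices, i.e., one in which every hyperedge with at least two vertices is non-monochromatic. The VC-dimension of $\mathcal{H}$ is the size of its largest subset of vertices $\mathcal{V}'\subseteq\mathcal{V}$ that can be shattered, that is, such that for every subset $\mathcal{V}''\subseteq\mathcal{V}'$ there exists a hyperedge $h\in\mathcal{E}$ with $h\cap\mathcal{V}'=\mathcal{V}''$. In (iii), $k$ is an integer parameter.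
   Formalization: For c'>0 the bounds ''at most 2c'' in (i) and (ii) are proved as ''at most ⌈2c⌉'' (the literal bound fails for non-integral 2c, e.g. one edge on 2 vertices, c=0.7, c'=0.4); in (iii) k is positive, and k ≤ n is required when d=0. *)

(* Defs.v *)
From HB Require Import structures.
From mathcomp Require Import all_boot all_order all_algebra.
From mathcomp Require Import reals.

Set Implicit Arguments.
Unset Strict Implicit.
Unset Printing Implicit Defensive.

Import Order.TTheory GRing.Theory Num.Theory.

Local Open Scope nat_scope.

(* The empty set is allowed as a hyperedge; note, however, that [induced]
   always discards it. *)
Record hypergraph := Hypergraph {
  vertex :> finType;
  hyperedges : {set {set vertex}}
}.

(* The vertex set of [induced A] is the type of the elements of A, and the
   preimage of h under val is the trace of h on A. *)
Definition induced (H : hypergraph) (A : {set H}) : hypergraph :=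
  @Hypergraph {x : H | x \in A}
    ([set val @^-1: h | h : {set H} in hyperedges H] :\ set0).

Definition delaunay (H : hypergraph) : hypergraph :=
  @Hypergraph H [set h in hyperedges H | #|h| == 2].

Definition proper_coloring (H : hypergraph) (C : eqType) (f : H -> C) : bool :=
  [forall h : {set H}, (h \in hyperedges H) && (1 < #|h|) ==>
    [exists x in h, exists y in h, f x != f y]].

Definition colorable (H : hypergraph) (k : nat) : bool :=
  [exists f : {ffun H -> 'I_k}, proper_coloring f].

Lemma ex_colorable (H : hypergraph) : exists k, colorable H k.
Proof.
exists #|H|; apply/existsP; exists [ffun x => enum_rank x].
apply/forallP => h; apply/implyP => /andP[_ /card_gt1P[x [y [hx hy xy]]]].
apply/existsP; exists x; rewrite hx; apply/existsP; exists y.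
by rewrite hy !ffunE (inj_eq enum_rank_inj).
Qed.

Definition chromatic_number (H : hypergraph) : nat := ex_minn (ex_colorable H).

Definition shattered (H : hypergraph) (A : {set H}) : bool :=
  [forall B : {set H}, (B \subset A) ==>
    [exists h in hyperedges H, h :&: A == B]].

(* Equal to 0 when H has no hyperedge, in which case no set is shattered. *)
Definition VC_dim (H : hypergraph) : nat :=
  \max_(A : {set H} | shattered A) #|A|.

Local Open Scope ring_scope.

(* Since 2 * c need not be an integer, a bound "at most 2c" drawn from c' > 0
   only holds with the ceiling of 2 * c: the single hyperedge on two vertices
   satisfies this with c = 7/10 and c' = 2/5, and its chromatic number is 2. *)
Definition delaunay_sparse (R : realType) (c c' : R) (H : hypergraph) : Prop :=
  forall A : {set H}, A != set0 ->
    #|hyperedges (delaunay (induced A))|%:R <= c * #|A|%:R - c'.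

(* Main.v *)
Require Import Defs.
From HB Require Import structures.
From mathcomp Require Import all_boot all_order all_algebra.
From mathcomp Require Import reals zify lra.

Set Implicit Arguments.
Unset Strict Implicit.
Unset Printing Implicit Defensive.

Import Order.TTheory GRing.Theory Num.Theory.

Local Open Scope nat_scope.

(** Everything reduces to one integer condition: the Delaunay graph of the
    trace on any non-empty vertex set A has average degree less than K.  It
    follows from the hypothesis with K the floor of 2c plus 1, and, when c' is
    positive, also with K the ceiling of 2c.

    For the chromatic number, the Delaunay graph of the trace on A has a vertex
    v with at most K - 1 neighbours.  Colour A without v by induction and give
    v a colour that none of its neighbours has.  A hyperedge whose trace on A
    has two elements and contains v is non-monochromatic by this choice; any
    other hyperedge that matters still has two elements in A without v, and is
    taken care of by the induction.

    For the VC-dimension, the Delaunay graph of the trace on a shattered set of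
    size d is complete, so that its average degree d - 1 is less than K.

    For the small hyperedges, let F be the set of those of size at most k.  By
    Pajor's form of the Sauer-Shelah lemma ([card_le_shattered]), F has at most
    as many members as it shatters sets.  A set shattered by F has at most d
    elements, where d is the VC-dimension, and any two of them lie in a common
    member of F: it is a clique of the graph of these close pairs.  This graph
    is sparse on every vertex set A, by the sampling argument of Clarkson and
    Shor ([card_close_pairs]): keep each vertex of A with probability 1/(2k); a
    close pair is then an edge of the Delaunay graph of the trace on the sample
    with probability at least (1/(2k))^2 / 2, whereas the expected number of
    edges of that graph is at most (K/2) |A| / (2k).  Hence there are at most
    2Kk|A| close pairs in A, so the graph of close pairs is 4Kk-degenerate, and
    a D-degenerate graph on n vertices has at most 1 + n (D + 1)^(d - 1)
    cliques of size at most d ([card_cliques]).  Since d <= K, the factor in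
    front of k^(d - 1) n is bounded in terms of c only. *)

(** * Degrees in graphs given by their edge sets *)

Lemma ex_min_degree (T : finType) (A : {set T}) (G : {set {set T}}) :
  A != set0 -> {in G, forall e : {set T}, e \subset A /\ #|e| = 2} ->
  exists2 v, v \in A & #|A| * #|[set e in G | v \in e]| <= 2 * #|G|.
Proof.
move=> /set0Pn[x xA] GA; pose deg v := #|[set e in G | v \in e]|.
have [v vA vmin] := arg_minnP (P := mem A) deg xA; exists v => //.
have -> : 2 * #|G| = \sum_(u in A) deg u.
  rewrite (eq_bigr (fun u => \sum_(e in G) (u \in e : nat))); last first.
    by move=> u _; rewrite /deg -sum1dep_card big_mkcondr.
  rewrite exchange_big /= mulnC -sum_nat_const; apply: eq_bigr => e eG.
  have [eA <-] := GA e eG; rewrite -sum1_card -big_mkcondr /=.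
  by apply: eq_bigl => u; apply/idP/andP => [ue|[]//]; rewrite (subsetP eA).
by rewrite -sum_nat_const; apply: leq_sum => u uA; apply: vmin.
Qed.

Lemma card_neighbors_le (T : finType) (G : {set {set T}}) (v : T) :
  #|[set y | (y != v) && ([set v; y] \in G)]| <= #|[set e in G | v \in e]|.
Proof.
rewrite -(card_in_imset (f := fun y => [set v; y])).
  apply/subset_leq_card/subsetP => e /imsetP[y]; rewrite inE => /andP[_ vyG] ->.
  by rewrite !inE vyG eqxx.
move=> y z; rewrite !inE => /andP[yv _] _ /setP/(_ y).
by rewrite !inE eqxx orbT (negPf yv) => /esym/eqP.
Qed.

(** * Delaunay graphs of traces *)

(** The edges of the Delaunay graph of the trace on A, as subsets of the whole
    vertex set, so that different choices of A can be compared without changing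
    the type of vertices. *)
Definition trace_edges (H : hypergraph) (A : {set H}) : {set {set H}} :=
  [set e : {set H} | (#|e| == 2) && [exists h in hyperedges H, h :&: A == e]].

Lemma trace_edgesP (H : hypergraph) (A e : {set H}) :
  reflect (#|e| = 2 /\ exists2 h, h \in hyperedges H & h :&: A = e)
          (e \in trace_edges A).
Proof.
rewrite inE; apply: (iffP andP) => -[].
  by move=> /eqP e2 /existsP[h /andP[hH /eqP hA]]; split=> //; exists h.
move=> e2 [h hH hA]; split; first exact/eqP.
by apply/existsP; exists h; rewrite hH hA eqxx.
Qed.

Lemma trace_edges_sub (H : hypergraph) (A : {set H}) :
  {in trace_edges A, forall e : {set H}, e \subset A /\ #|e| = 2}.
Proof. by move=> e /trace_edgesP[e2 [h _ hA]]; rewrite -[in X in X /\ _]hA subsetIr. Qed.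

Lemma card_trace_edges (H : hypergraph) (A : {set H}) :
  #|trace_edges A| <= #|hyperedges (delaunay (induced A))|.
Proof.
pose S : finType := {x : H | x \in A}.
pose f (e : {set H}) : {set S} := [set x : S | val x \in e].
have fK (e : {set H}) : e \subset A -> val @: f e = e.
  move=> eA; apply/setP => x; apply/imsetP/idP => [[y]|xe].
    by rewrite inE => ye ->.
  by exists (Sub x (subsetP eA x xe)) => //; rewrite inE.
rewrite -(card_in_imset (f := f)).
  apply/subset_leq_card/subsetP => _ /imsetP[e eG ->].
  have [eA e2] := trace_edges_sub eG.
  have /trace_edgesP[_ [h hH hA]] := eG.
  have fe2 : #|f e| = 2 by rewrite -e2 -[in RHS](fK e eA) card_imset //; apply: val_inj.
  rewrite inE; apply/andP; split; last exact/eqP.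
  rewrite !inE -card_gt0 fe2 /=; apply/imsetP; exists h => //.
  by apply/setP => x; rewrite !inE -hA inE (valP x) andbT.
move=> e e' /trace_edges_sub[eA _] /trace_edges_sub[e'A _] fee.
by rewrite -(fK e eA) fee fK.
Qed.

(** The strict inequality makes the minimum degree at most K - 1, which is what
    a greedy colouring with K colours needs. *)
Definition trace_sparse (H : hypergraph) (K : nat) : Prop :=
  forall A : {set H}, A != set0 -> 2 * #|trace_edges A| < K * #|A|.

(** * Chromatic number *)

(** Greedy colouring along the order obtained by removing vertices of minimum
    degree.  This graph is recomputed at each removal and may gain edges; this
    is harmless, because only the traces that shrink to a single vertex when v
    is removed constrain the colour of v. *)
Lemma colorable_of_sparse (H : hypergraph) (K : nat) :
  trace_sparse H K -> colorable H K.
Proof.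
move=> sparse.
(* Colours are natural numbers because K may be 0 when H has no vertex. *)
have col (A : {set H}) : exists2 f : H -> nat,
    {in A, forall x, f x < K} &
    forall h, h \in hyperedges H -> 1 < #|h :&: A| ->
      exists x y, [/\ x \in h :&: A, y \in h :&: A & f x != f y].
  have [n] := ubnP #|A|; elim: n A => // n IHn A An.
  have [->|A0] := eqVneq A set0.
    by exists (fun=> 0) => [x|h _]; rewrite ?setI0 ?cards0 ?inE.
  have [v vA vdeg] := ex_min_degree A0 (@trace_edges_sub H A).
  have {}vdeg : #|[set e in trace_edges A | v \in e]| < K.
    rewrite -(ltn_pmul2l (m := #|A|)) ?card_gt0 // (leq_ltn_trans vdeg) //.
    by rewrite [X in _ < X]mulnC sparse.
  have [f fK fP] : exists2 f : H -> nat, {in A :\ v, forall x, f x < K} &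
    forall h, h \in hyperedges H -> 1 < #|h :&: (A :\ v)| ->
      exists x y, [/\ x \in h :&: (A :\ v), y \in h :&: (A :\ v) & f x != f y].
    by apply: IHn; move: An; rewrite (cardsD1 v) vA.
  pose N := [set y | (y != v) && ([set v; y] \in trace_edges A)].
  have [i iK iN] : exists2 i, i < K & i \notin [seq f y | y in N].
    have /hasP[i iK iN] : has [predC [seq f y | y in N]] (iota 0 K).
      rewrite has_predC; apply/negP => /allP sub.
      have := uniq_leq_size (iota_uniq 0 K) sub.
      rewrite size_iota size_image leqNgt => /negP; apply.
      exact: leq_ltn_trans (card_neighbors_le _ _) vdeg.
    by exists i => //; move: iK; rewrite mem_iota.
  exists (fun x => if x == v then i else f x) => [x xA|h hH hA].
    by have [//|xv] := eqVneq x v; rewrite fK // !inE xv.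
  have [big|small] := ltnP 1 #|h :&: (A :\ v)|.
    have [x [y [/setIP[xh /setD1P[xv xA]] /setIP[yh /setD1P[yv yA]] fxy]]] :=
      fP h hH big.
    by exists x, y; rewrite (negPf xv) (negPf yv) !inE xh xA yh yA.
  (* The trace of h on A has two elements, so it is an edge at v. *)
  have hD : h :&: (A :\ v) = (h :&: A) :\ v by rewrite setIDA.
  have vh : v \in h :&: A.
    apply: contraLR hA => vh; rewrite -leqNgt (leq_trans _ small) // hD.
    by rewrite [X in X <= _](cardsD1 v) (negPf vh).
  have : #|(h :&: A) :\ v| == 1 by move: hA small; rewrite hD (cardsD1 v (h :&: A)) vh; lia.
  case/cards1P=> y hy; have hvy : h :&: A = [set v; y] by rewrite -(setD1K vh) hy.
  have /setD1P[yv yA] : y \in (h :&: A) :\ v by rewrite hy inE.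
  exists v, y; split=> //; rewrite eqxx (negPf yv).
  apply: contra iN => /eqP ->; apply/image_f.
  rewrite inE yv; apply/trace_edgesP; split; last by exists h.
  by rewrite cards2 eq_sym yv.
have [f fK fP] := col setT.
apply/existsP; exists [ffun x => Ordinal (fK x (in_setT x))].
apply/forallP => h; apply/implyP => /andP[hH h1].
have [|x [y []]] := fP h hH; first by rewrite setIT.
rewrite setIT => xh yh fxy; apply/existsP; exists x; rewrite xh.
by apply/existsP; exists y; rewrite yh !ffunE -val_eqE.
Qed.

(** * VC-dimension *)

Lemma shatteredP (H : hypergraph) (A : {set H}) :
  reflect (forall B : {set H}, B \subset A ->
             exists2 h, h \in hyperedges H & h :&: A = B)
          (shattered A).
Proof.
apply: (iffP forallP) => sh B.
  move=> BA; have /implyP/(_ BA)/existsP[h /andP[hH /eqP hB]] := sh B.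
  by exists h.
apply/implyP => /sh[h hH hB]; apply/existsP; exists h.
by rewrite hH hB eqxx.
Qed.

(** All pairs of elements of a shattered set are traces on it, which leaves no
    room for more than K elements in a graph of average degree less than K. *)
Lemma VC_dim_of_sparse (H : hypergraph) (K : nat) :
  trace_sparse H K -> VC_dim H <= K.
Proof.
move=> sparse; apply/bigmax_leqP => A /shatteredP shA.
have [->|A0] := eqVneq A set0; first by rewrite cards0.
have := sparse A A0.
have -> : trace_edges A = [set e : {set H} | e \subset A & #|e| == 2].
  apply/setP => e; apply/idP/idP.
    by move=> /trace_edges_sub[eA e2]; rewrite inE eA e2.
  rewrite inE => /andP[eA /eqP e2]; apply/trace_edgesP; split=> //.
  exact: shA.
rewrite cards_draws bin2.
have := odd_double_half (#|A| * #|A|.-1).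
have -> : odd (#|A| * #|A|.-1) = false.
  by case: #|A| => // m; rewrite oddM /=; case: odd.
move: A0; rewrite -card_gt0; case: #|A| => // m _ /=.
by rewrite add0n -mul2n => ->; rewrite mulnC ltn_pmul2r.
Qed.

(** Pajor's lemma.  Split F by a vertex x on which two members differ, and apply
    induction to both parts.  Neither part shatters a set that contains x, so
    a set B shattered by both is counted twice in the sum of the two bounds, and
    x |: B, which is then shattered by F, pays for the second time. *)
Lemma card_le_shattered (T : finType) (F : {set {set T}}) :
  #|F| <= #|[set B : {set T} | @shattered (@Hypergraph T F) B]|.
Proof.
pose Sh (F : {set {set T}}) : {set {set T}} := [set B | @shattered (@Hypergraph T F) B].
have ShP (E : {set {set T}}) (B : {set T}) : reflect
    (forall C : {set T}, C \subset B -> exists2 h, h \in E & h :&: B = C)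
    (B \in Sh E) by rewrite inE; apply: (@shatteredP (@Hypergraph T E)).
have ShS (E E' : {set {set T}}) : E \subset E' -> Sh E \subset Sh E'.
  move=> /subsetP EE'; apply/subsetP => B /ShP EB; apply/ShP => C /EB[h hE hC].
  by exists h => //; apply: EE'.
rewrite -/(Sh F); have [n] := ubnP #|F|; elim: n F => // n IHn F Fn.
have [F1|] := leqP #|F| 1.
  have [->|[h hF]] := set_0Vmem F; first by rewrite cards0.
  rewrite (leq_trans F1) // card_gt0; apply/set0Pn; exists set0.
  by apply/ShP => C; rewrite subset0 => /eqP ->; exists h; rewrite ?setI0.
move=> /card_gt1P[h [h' [hF h'F hh']]].
have [x xhh'] : exists x, (x \in h) != (x \in h').
  apply/existsP; apply: contraR hh'; rewrite negb_exists => /forallP hh'.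
  by apply/eqP/setP => x; apply/eqP; move: (hh' x); rewrite negbK.
pose F1 := [set g in F | x \in g]; pose F0 := [set g in F | x \notin g].
have F10 : #|F| = #|F1| + #|F0|.
  rewrite -(cardsID [set g : {set T} | x \in g] F).
  by congr (_ + _); apply: eq_card => g; rewrite !inE // andbC.
have [F1pos F0pos] : 0 < #|F1| /\ 0 < #|F0|.
  rewrite !card_gt0; move: xhh'; case xh: (x \in h); case xh': (x \in h') => // _;
    split; apply/set0Pn; [exists h|exists h'|exists h'|exists h];
    by rewrite inE ?hF ?h'F ?xh ?xh'.
have sF1 : F1 \subset F by apply/subsetP => g; rewrite inE => /andP[].
have sF0 : F0 \subset F by apply/subsetP => g; rewrite inE => /andP[].
have xSh1 B : B \in Sh F1 -> x \notin B.
  move=> /ShP/(_ set0 (sub0set _))[g]; rewrite inE => /andP[_ xg] /setP/(_ x).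
  by rewrite !inE xg /= => ->.
have xSh0 B : B \in Sh F0 -> x \notin B.
  move=> /ShP/(_ B (subxx _))[g]; rewrite inE => /andP[_ xg] /setP/(_ x).
  by rewrite !inE (negPf xg) /= => <-.
have Ule : #|F| <= #|Sh F1 :|: Sh F0| + #|Sh F1 :&: Sh F0|.
  rewrite cardsUI F10 leq_add ?IHn //; move: Fn; rewrite F10; lia.
apply: (leq_trans Ule).
have <- : #|[set x |: B | B in Sh F1 :&: Sh F0]| = #|Sh F1 :&: Sh F0|.
  apply: card_in_imset => B C /setIP[/xSh1 xB _] /setIP[/xSh1 xC _] BC.
  by rewrite -(setU1K xB) BC setU1K.
rewrite -cardsUI [X in _ + X](_ : _ = 0) ?addn0.
  apply/subset_leq_card; rewrite subUset subUset (ShS _ _ sF1) (ShS _ _ sF0) /=.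
  apply/subsetP => _ /imsetP[B /setIP[B1 B0] ->]; apply/ShP => C CxB.
  have CB : C :\ x \subset B by rewrite subDset.
  have xB := xSh1 B B1.
  have [xC|xC] := boolP (x \in C).
    have /ShP/(_ _ CB)[g] := B1; rewrite inE => /andP[gF xg] gB; exists g => //.
    by rewrite setIUr gB (setIidPr _) ?sub1set // setD1K.
  have /ShP/(_ _ CB)[g] := B0; rewrite inE => /andP[gF xg] gB; exists g => //.
  rewrite setIUr gB (_ : g :&: [set x] = set0) ?set0U.
    by apply/setDidPl; rewrite disjoint_sym disjoints1.
  by apply/setP => y; rewrite !inE; case: eqP => [->|]; rewrite ?(negPf xg) ?andbF.
apply: eq_card0 => B; rewrite inE; apply/negbTE/negP => /andP[/setUP xB /imsetP[C _ BC]].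
have : x \in B by rewrite BC setU11.
by apply/negP; case: xB => [/xSh1|/xSh0].
Qed.

(** * Cliques of degenerate graphs *)

Lemma card_small_subsets (T : finType) (N : {set T}) (d : nat) :
  #|[set X : {set T} | X \subset N & #|X| <= d]| <= #|N|.+1 ^ d.
Proof.
elim: d => [|d IHd].
  rewrite expn0 -(cards1 (set0 : {set T})); apply/subset_leq_card/subsetP => X.
  by rewrite !inE leqn0 cards_eq0 => /andP[].
set S := fun m => [set X : {set T} | X \subset N & #|X| <= m].
rewrite -/(S d.+1); rewrite -/(S d) in IHd.
have sub : S d.+1 \subset
    S d :|: [set p.1 |: p.2 | p : T * {set T} in setX N (S d)].
  apply/subsetP => X; rewrite !inE => /andP[XN Xd].
  have [->|[x xX]] := set_0Vmem X; first by rewrite sub0set cards0.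
  apply/orP; right; apply/imsetP; exists (x, X :\ x); last by rewrite /= setD1K.
  rewrite !inE /= (subsetP XN) //= (subset_trans (subsetDl _ _) XN) /=.
  by move: Xd; rewrite (cardsD1 x) xX.
apply: leq_trans (subset_leq_card sub) _.
apply: leq_trans (leq_card_setU _ _) _.
rewrite expnS mulSn leq_add //.
by apply: leq_trans (leq_imset_card _ _) _; rewrite cardsX leq_mul.
Qed.

Definition clique (T : finType) (G : {set {set T}}) (B : {set T}) : bool :=
  [forall x in B, forall y in B, (x != y) ==> ([set x; y] \in G)].

Lemma cliqueP (T : finType) (G : {set {set T}}) (B : {set T}) :
  reflect {in B &, forall x y, x != y -> [set x; y] \in G} (clique G B).
Proof.
apply: (iffP forall_inP) => cl x.
  by move=> y xB yB; apply/implyP; move: y yB; apply/forall_inP/cl.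
by move=> xB; apply/forall_inP => y yB; apply/implyP; apply: cl.
Qed.

(** Remove a vertex v of small degree: the cliques that contain v are given by
    sets of at most d neighbours of v.  The 1 counts the empty clique. *)
Lemma card_cliques (T : finType) (G : {set {set T}}) (D d : nat) (A : {set T}) :
  (forall A : {set T}, A != set0 -> exists2 v, v \in A &
     #|[set e in [set e in G | e \subset A] | v \in e]| <= D) ->
  #|[set B : {set T} | [&& B \subset A, #|B| <= d.+1 & clique G B]]|
    <= 1 + #|A| * D.+1 ^ d.
Proof.
move=> degen.
pose Cl (A : {set T}) := [set B : {set T} | [&& B \subset A, #|B| <= d.+1 & clique G B]].
rewrite -/(Cl A); have [n] := ubnP #|A|; elim: n A => // n IHn A An.
have [->|A0] := eqVneq A set0.
  rewrite cards0 mul0n addn0 -(cards1 (set0 : {set T})).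
  by apply/subset_leq_card/subsetP => B; rewrite !inE subset0 => /andP[].
have [v vA vdeg] := degen A A0.
pose N := [set y | (y != v) && ([set v; y] \in [set e in G | e \subset A])].
have sub : Cl A \subset Cl (A :\ v) :|:
    [set v |: X | X in [set X : {set T} | X \subset N & #|X| <= d]].
  apply/subsetP => B; rewrite !inE => /and3P[BA Bd Bcl].
  have [vB|vB] := boolP (v \in B); last by rewrite subsetD1 BA vB Bd Bcl.
  apply/orP; right; apply/imsetP; exists (B :\ v); last by rewrite setD1K.
  rewrite inE; apply/andP; split; last by move: Bd; rewrite (cardsD1 v) vB.
  apply/subsetP => y /setD1P[yv yB]; rewrite !inE yv /=.
  rewrite (cliqueP _ _ Bcl) 1?[v == y]eq_sym //=.
  by rewrite subUset !sub1set vA (subsetP BA).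
apply: leq_trans (subset_leq_card sub) _.
apply: leq_trans (leq_card_setU _ _) _.
have IH : #|Cl (A :\ v)| <= 1 + #|A :\ v| * D.+1 ^ d.
  by apply: IHn; move: An; rewrite (cardsD1 v) vA.
have Nle : #|[set v |: X | X in [set X : {set T} | X \subset N & #|X| <= d]]| <= D.+1 ^ d.
  apply: leq_trans (leq_imset_card _ _) _.
  apply: leq_trans (card_small_subsets _ _) _.
  by case: (d) => // d'; rewrite leq_exp2r // ltnS; exact: leq_trans (card_neighbors_le _ _) vdeg.
by rewrite (cardsD1 v A) vA mulnDl mul1n addnCA addnC leq_add.
Qed.

(** * Sampling *)

Lemma card_const_on (T C : finType) (B : {set T}) (i : C) :
  #|[set f : {ffun T -> C} | [forall w in B, f w == i]]| = #|C| ^ (#|T| - #|B|).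
Proof.
rewrite -(cardsC B) addKn -(card_pffun_on i (mem (~: B)) (mem C)).
apply: eq_card => f; rewrite !inE.
apply/forall_inP/pffun_onP => [fB|[fB _] w wB].
  by split=> //; apply/subsetP => w; rewrite !inE; apply: contra => /fB.
by apply/eqP; apply: contraTeq wB => fw; have := subsetP fB w; rewrite !inE => ->.
Qed.

(** The vertices of colour 0 in a uniform random colouring with q + 1 colours
    form a random sample of density 1/(q + 1).  These are the colourings for
    which this sample meets h exactly in e, when e is contained in h. *)
Definition isolating (T : finType) (q : nat) (e h : {set T}) :
    {set {ffun T -> 'I_q.+1}} :=
  [set f : {ffun T -> 'I_q.+1} |
    [forall w in e, f w == ord0] && [forall w in h :\: e, f w != ord0]].

(** Given that e is in the sample, each element of h outside e is in the sample
    with probability 1/(q + 1), and there are at most (q + 1)/2 of them; by the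
    union bound, none of them is sampled with probability at least 1/2. *)
Lemma card_isolating_ge (T : finType) (q : nat) (e h : {set T}) :
  e \subset h -> 2 * #|h| <= q.+1 ->
  q.+1 ^ (#|T| - #|e|) <= 2 * #|isolating q e h|.
Proof.
move=> eh hq; pose Z (B : {set T}) :=
  [set f : {ffun T -> 'I_q.+1} | [forall w in B, f w == ord0]].
have ZE B : #|Z B| = q.+1 ^ (#|T| - #|B|) by rewrite card_const_on card_ord.
have sub : Z e \subset isolating q e h :|: \bigcup_(z in h :\: e) Z (z |: e).
  apply/subsetP => f; rewrite !inE => fe; rewrite fe /=.
  have [//|] := boolP [forall w in h :\: e, f w != ord0].
  rewrite negb_forall => /existsP[z]; rewrite negb_imply negbK => /andP[zh fz].
  apply/bigcupP; exists z => //; rewrite inE; apply/forall_inP => w.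
  by case/setU1P => [->//|]; apply: (forall_inP fe).
have Zz z : z \in h :\: e -> 2 * #|h| * #|Z (z |: e)| <= q.+1 ^ (#|T| - #|e|).
  move=> /setDP[zh ze]; rewrite ZE cardsU1 ze add1n.
  have lt : #|e| < #|T|.
    rewrite -cardsT; apply: proper_card; apply/properP.
    by split; [apply: subsetT|exists z].
  by rewrite subnS -[in leqRHS](prednK (n := #|T| - #|e|)) ?subn_gt0 // expnS leq_mul2r hq orbT.
have union : 2 * #|\bigcup_(z in h :\: e) Z (z |: e)| <= q.+1 ^ (#|T| - #|e|).
  have [h0|h0] := posnP #|h|.
    by rewrite big_pred0 ?cards0 // => z; rewrite !inE (cards0_eq h0) inE andbF.
  rewrite -(leq_pmul2l h0) mulnA (mulnC #|h|).
  have le : #|\bigcup_(z in h :\: e) Z (z |: e)| <= \sum_(z in h :\: e) #|Z (z |: e)|.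
    elim/big_rec2: _ => [|z m U _ IH]; first by rewrite cards0.
    by apply: leq_trans (leq_card_setU _ _) _; rewrite leq_add2l.
  apply: leq_trans (leq_mul (leqnn _) le) _; rewrite big_distrr /=.
  apply: leq_trans (leq_sum _ Zz) _.
  by rewrite sum_nat_const leq_mul // subset_leq_card // subsetDl.
have half (a b c : nat) : a <= b + c -> 2 * c <= a -> a <= 2 * b by lia.
apply: half union; rewrite -ZE.
exact: leq_trans (subset_leq_card sub) (leq_card_setU _ _).
Qed.

Definition close_pairs (H : hypergraph) (k : nat) : {set {set H}} :=
  [set e : {set H} | (#|e| == 2) &&
    [exists h in hyperedges H, (#|h| <= k) && (e \subset h)]].

(** The Clarkson-Shor argument, as a double count of the pairs of a colouring
    with 2k colours and an edge of the Delaunay graph of the trace on its class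
    0 in A. *)
Lemma card_close_pairs (H : hypergraph) (K k : nat) (A : {set H}) :
  trace_sparse H K -> 0 < k -> #|[set e in close_pairs H k | e \subset A]| <= K * (2 * k) * #|A|.
Proof.
move=> sparse k0; set G := [set e in _ | _].
(* The successor form provides the colour ord0. *)
have [q qE] : exists q, 2 * k = q.+1 by exists (2 * k).-1; lia.
pose S (f : {ffun H -> 'I_q.+1}) := [set x in A | f x == ord0].
have total : \sum_f #|S f| = #|A| * q.+1 ^ #|H|.-1.
  rewrite (eq_bigr (fun f : {ffun H -> 'I_q.+1} => \sum_(x in A) (f x == ord0 : nat))); last first.
    by move=> f _; rewrite -sum1dep_card big_mkcondr.
  rewrite exchange_big /= -sum_nat_const; apply: eq_bigr => x _.
  rewrite -big_mkcond /= sum1dep_card -subn1 -(cards1 x) -[in RHS](card_ord q.+1).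
  rewrite -(card_const_on _ ord0); apply: eq_card => f; rewrite !inE.
  by apply/idP/forall_inP => [fx w /set1P->|->]; rewrite ?inE.
have bound : 2 * \sum_f #|trace_edges (S f)| <= K * \sum_f #|S f|.
  rewrite !big_distrr /=; apply: leq_sum => f _.
  have [->|/sparse/ltnW//] := eqVneq (S f) set0.
  rewrite cards0 muln0 leqn0 muln_eq0 /= cards_eq0; apply/eqP/setP => e.
  rewrite [RHS]inE; apply/negP => /trace_edges_sub[]; rewrite subset0 => /eqP ->.
  by rewrite cards0.
have iso : #|G| * q.+1 ^ (#|H| - 2) <= 2 * \sum_f #|trace_edges (S f)|.
  have -> : \sum_f #|trace_edges (S f)|
      = \sum_(e : {set H}) #|[set f : {ffun H -> 'I_q.+1} | e \in trace_edges (S f)]|.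
    rewrite (eq_bigr (fun f : {ffun H -> 'I_q.+1} =>
      \sum_(e : {set H}) (e \in trace_edges (S f) : nat))).
      by rewrite exchange_big; apply: eq_bigr => e _; rewrite -big_mkcond sum1dep_card.
    by move=> f _; rewrite -big_mkcond sum1_card.
  rewrite big_distrr /= -sum_nat_const [X in _ <= X](bigID (mem G)) /=.
  rewrite (leq_trans _ (leq_addr _ _)) //; apply: leq_sum => e.
  rewrite !inE => /andP[/andP[/eqP e2 /existsP[h /and3P[hH hk eh]]] eA].
  rewrite -[X in _ - X]e2; apply: leq_trans (card_isolating_ge eh (q := q) _) _.
    by rewrite -qE leq_mul2l.
  rewrite leq_mul2l /=; apply/subset_leq_card/subsetP => f; rewrite !inE.
  move=> /andP[/forall_inP fe /forall_inP fh]; rewrite e2 eqxx /=.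
  apply/existsP; exists h; rewrite hH /=; apply/eqP/setP => x; rewrite !inE.
  apply/and3P/idP => [[xh xA fx]|xe].
    by apply: contraLR fx => xe; apply: fh; rewrite !inE xe.
  by rewrite (subsetP eh) ?(subsetP eA) ?fe.
have [G0|] := posnP #|G|; first by rewrite G0.
move=> /card_gt0P[e]; rewrite !inE => /andP[/andP[/eqP e2 _] _].
have H2 : 1 < #|H| by rewrite -e2 max_card.
have := leq_trans iso bound; rewrite total.
have -> : #|H|.-1 = (#|H| - 2).+1 by lia.
rewrite expnS !mulnA leq_pmul2r ?expn_gt0 // -qE; lia.
Qed.

(** * Small hyperedges *)

Lemma card_small_hyperedges (H : hypergraph) (K k : nat) :
  trace_sparse H K -> 0 < k -> 0 < VC_dim H ->
  #|[set h in hyperedges H | #|h| <= k]|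
    <= (1 + (4 * K).+1 ^ K) * (k ^ (VC_dim H).-1 * #|H|).
Proof.
move=> sparse k0 d0; set F := [set h in _ | _].
set d := (VC_dim H).-1; have dE : VC_dim H = d.+1 by rewrite /d prednK.
have shF (B : {set H}) : @shattered (@Hypergraph H F) B -> shattered B.
  move=> /shatteredP shB; apply/shatteredP => C /shB[h /=].
  by rewrite inE => /andP[hH _] hB; exists h.
have H0 : 0 < #|H|.
  move: d0; apply: contraLR; rewrite -!leqNgt => H0.
  apply/bigmax_leqP => A _; exact: leq_trans (max_card _) H0.
have degen (A : {set H}) : A != set0 -> exists2 v, v \in A &
    #|[set e in [set e in close_pairs H k | e \subset A] | v \in e]| <= 4 * K * k.
  move=> A0; pose G := [set e in close_pairs H k | e \subset A].
  have [|v vA vdeg] := ex_min_degree (G := G) A0.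
    by move=> e; rewrite !inE => /andP[/andP[/eqP -> _] ->].
  exists v => //; rewrite -(leq_pmul2l (m := #|A|)) ?card_gt0 //.
  apply: leq_trans vdeg _; rewrite /G; have := card_close_pairs A sparse k0; lia.
have sub : [set B : {set H} | @shattered (@Hypergraph H F) B] \subset
    [set B : {set H} | [&& B \subset setT, #|B| <= d.+1 & clique (close_pairs H k) B]].
  apply/subsetP => B; rewrite !inE subsetT /= => shB; apply/andP; split.
    by rewrite -dE; apply: (leq_bigmax_cond B (shF B shB)).
  have [h /=] := @shatteredP (@Hypergraph H F) B shB B (subxx _).
  rewrite inE => /andP[hH hk] /setIidPr Bh.
  apply/cliqueP => x y xB yB xy; rewrite inE cards2 xy; apply/existsP; exists h.
  by rewrite hH hk subUset !sub1set !(subsetP Bh).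
apply: leq_trans (card_le_shattered F) _.
apply: leq_trans (subset_leq_card sub) _.
apply: leq_trans (card_cliques _ _ degen) _; rewrite cardsT mulnDl mul1n.
apply: leq_add; first by rewrite muln_gt0 expn_gt0 k0 H0.
rewrite mulnA [leqRHS]mulnC leq_mul2l; apply/orP; right.
apply: (leq_trans (n := ((4 * K).+1 * k) ^ d)).
  by case: (d) => // d'; rewrite leq_exp2r // mulSn; lia.
rewrite expnMn leq_mul2r leq_pexp2l ?orbT //.
by have := VC_dim_of_sparse sparse; rewrite dE; apply: ltnW.
Qed.

Lemma card_hyperedges_VC_dim0 (H : hypergraph) :
  VC_dim H = 0 -> #|hyperedges H| <= 1.
Proof.
move=> d0; apply: leq_trans (card_le_shattered _) _.
rewrite -(cards1 (set0 : {set H})); apply/subset_leq_card/subsetP => B.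
rewrite !inE -cards_eq0 -leqn0 -d0 => shB; apply: (leq_bigmax_cond B).
by case: H B shB {d0}.
Qed.

Local Open Scope ring_scope.

(** * From the real bound to the integer one *)

(** The strictness required by [trace_sparse] comes either from K exceeding 2c or
    from the subtracted constant c'. *)
Lemma sparse_trace_edges (R : realType) (c c' : R) (H : hypergraph) (K : nat) :
  delaunay_sparse c c' H -> 0 <= c' -> 2 * c <= K%:R ->
  0 < c' \/ 2 * c < K%:R ->
  trace_sparse H K.
Proof.
move=> sparse c'0 cK strict A A0.
have A1 : 0 < #|A|%:R :> R by rewrite ltr0n card_gt0.
have tr : #|trace_edges A|%:R <= c * #|A|%:R - c'.
  by apply: le_trans (sparse A A0); rewrite ler_nat card_trace_edges.
by rewrite -(ltr_nat R) !natrM; case: strict => strict; nra.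
Qed.

Theorem theorem6 (R : realType) (c c' : R) (c_ge0 : 0 <= c) (c'_ge0 : 0 <= c') :
  [/\ forall H : hypergraph, delaunay_sparse c c' H ->
        (chromatic_number H)%:R <= 2 * c + 1 /\
        (0 < c' -> (chromatic_number H)%:Z <= Num.ceil (2 * c)),
      forall H : hypergraph, delaunay_sparse c c' H ->
        (VC_dim H)%:R <= 2 * c + 1 /\
        (0 < c' -> (VC_dim H)%:Z <= Num.ceil (2 * c))
    & exists C : R, forall H : hypergraph, delaunay_sparse c c' H ->
        forall k : nat, (0 < k)%N -> (0 < VC_dim H)%N || (k <= #|H|)%N ->
          #|[set h in hyperedges H | (#|h| <= k)%N]|%:R
            <= C * (k%:R ^ ((VC_dim H)%:Z - 1) * #|H|%:R)].
Proof.
have c2_ge0 : 0 <= 2 * c by rewrite mulr_ge0.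
pose K := (Num.truncn (2 * c)).+1.
have K_gt : 2 * c < K%:R by apply: truncnS_gt.
have K_le : K%:R <= 2 * c + 1 by rewrite -[K%:R]natr1 lerD2r truncn_le.
have ceil_nat : Num.ceil (2 * c) = `|Num.ceil (2 * c)|%N.
  by rewrite gez0_abs // -(ceil0 R) le_ceil.
have sparseK (H : hypergraph) : delaunay_sparse c c' H -> trace_sparse H K.
  by move=> sp; apply: sparse_trace_edges sp _ (ltW K_gt) _ => //; right.
have sparse_ceil (H : hypergraph) : delaunay_sparse c c' H -> 0 < c' ->
    trace_sparse H `|Num.ceil (2 * c)|%N.
  move=> sp c'0; apply: sparse_trace_edges sp _ _ _ => //; last by left.
  by rewrite [leRHS]pmulrn -ceil_nat ceil_ge.
have chromatic_le (H : hypergraph) m : colorable H m -> (chromatic_number H <= m)%N.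
  by rewrite /chromatic_number; case: ex_minnP => n _; apply.
split=> [H sp|H sp|].
- split=> [|c'0].
    apply: le_trans K_le; rewrite ler_nat.
    exact/chromatic_le/colorable_of_sparse/sparseK.
  rewrite ceil_nat lez_nat.
  exact/chromatic_le/colorable_of_sparse/sparse_ceil.
- split=> [|c'0].
    by apply: le_trans K_le; rewrite ler_nat; apply/VC_dim_of_sparse/sparseK.
  by rewrite ceil_nat lez_nat; apply/VC_dim_of_sparse/sparse_ceil.
exists (1 + (4 * K).+1 ^ K)%N%:R => H sp k k0.
have [d0 /= kH|d0 _] := posnP (VC_dim H).
  (* There is at most one hyperedge, while k <= #|H| makes k^-1 * #|H| at
     least 1. *)
  rewrite d0 sub0r; apply: (@le_trans _ _ 1).
    rewrite (ler_nat _ _ 1); apply: leq_trans (card_hyperedges_VC_dim0 d0).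
    by apply/subset_leq_card/subsetP => h; rewrite inE => /andP[].
  have kR : 0 < k%:R :> R by rewrite ltr0n.
  apply: (@le_trans _ _ (1 * (k%:R^-1 * #|H|%:R))).
    by rewrite mul1r mulrC ler_pdivlMr // mul1r ler_nat.
  by rewrite ler_wpM2r ?mulr_ge0 ?invr_ge0 // (ler_nat _ 1).
have -> : (VC_dim H)%:Z - 1 = (VC_dim H).-1 by rewrite -[in LHS](prednK d0) intS addrC addKr.
rewrite -exprnP -natrX -!natrM ler_nat.
exact: card_small_hyperedges (sparseK H sp) k0 d0.
Qed.
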